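(* Let $(P,g)$ be a Carrollian $\mathbb{R}^\times$-bundle, with projection $\pi:P\to M$, such that the Euler vector field is Killing, i.e. $\mathcal{L}_{\Delta_P}g=0$. Then the induced metric $g_M$ on $M$ (the symmetric covariant 2-tensor on $M$ with $g=\pi^*g_M$) is non-degenerate.
   Context: $\mathbb{R}^\times:=\mathbb{R}\setminus\{0\}$ with multiplication. A principal $\mathbb{R}^\times$-bundle $\pi:P\to M$ is a line bundle over $M$ with its zero section removed, with $\mathbb{R}^\times$ acting by fibrewise multiplication; adapted local coordinates are $(x^a,t)$, with $x^a$ coordinates on $M$, $t\neq 0$ the fibre coordinate, and action $(x^a,t)\mapsto(x^a,st)$, $s\in\mathbb{R}^\times$. The Euler vector field $\Delta_P$ is the fundamental vector field of this action, locally $\Delta_P=t\,\partial_t$; it globally generates the module $\mathrm{Sec}(VP)$ of vertical vector fields, $VP=\ker(d\pi)$. A Carrollian $\mathbb{R}^\times$-bundle is a pair $(P,g)$, where $P$ is a principal $\mathbb{R}^\times$-bundle and $g$ is a degenerate metric (smooth symmetric covariant 2-tensor) on the total space $P$ with $\{X\in\mathrm{Vect}(P): g(X,-)=0\}=\mathrm{Sec}(VP)$, understood pointwise: $\ker(g_p)=V_pP$ for all $p\in P$. Locally $g=g_{ab}(x,t)\,dx^a dx^b$. The condition $\mathcal{L}_{\Delta_P}g=0$ is taken to be equivalent to $g$ being invariant under the full $\mathbb{R}^\times$-action; locally $g=g_{ab}(x)\,dx^adx^b$ with no dependence on $t$, so $g$ is basic and is viewed as a tensor $g_M$ on $M$,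 the induced metric. *)

(* Defs.v *)
From HB Require Import structures.
From mathcomp Require Import all_boot all_order all_algebra.
From mathcomp Require Import all_classical all_reals all_analysis.

Set Implicit Arguments.
Unset Strict Implicit.
Unset Printing Implicit Defensive.

Import Order.TTheory GRing.Theory Num.Theory.
Import numFieldNormedType.Exports.

Local Open Scope classical_set_scope.
Local Open Scope ring_scope.

(* C^k and C^oo on a set U, which is open in every use below. *)
Fixpoint Ck (R : realType) (V W : normedModType R) (k : nat) (U : set V)
    (f : V -> W) : Prop :=
  if k is k'.+1
  then (forall x, U x -> differentiable f x) /\ (forall v, Ck k' U ('D_v f))
  else forall x, U x -> {for x, continuous f}.

Definition smooth_on (R : realType) (V W : normedModType R) (U : set V)
    (f : V -> W) : Prop :=
  forall k, Ck k U f.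

(* The values of [coord] off [dom] and of [param] off [coord @` dom] are
   irrelevant. *)
Record chart (R : realType) (n : nat) (M : topologicalType) := Chart {
  dom : set M;
  coord :> M -> 'rV[R]_n;
  param : 'rV[R]_n -> M;
  dom_open : open dom;
  cod_open : open (coord @` dom);
  coordK : forall p, dom p -> param (coord p) = p;
  coord_continuous : forall p, dom p -> {for p, continuous coord};
  param_continuous : forall p, dom p -> {for coord p, continuous param} }.

Definition compatible (R : realType) n (M : topologicalType)
    (c d : chart R n M) : Prop :=
  smooth_on (c @` (dom c `&` dom d)) (d \o param c) /\
  smooth_on (d @` (dom c `&` dom d)) (c \o param d).

Record manifold (R : realType) (n : nat) := Manifold {
  points :> topologicalType;
  atlas : set (chart R n points);
  manifold_hausdorff : hausdorff_space points;
  manifold_second_countable : @second_countable points;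
  atlas_cover : forall p, exists2 c, atlas c & dom c p;
  atlas_maximal : forall c,
    atlas c <-> (forall d, atlas d -> compatible c d) }.

Definition charts_at (R : realType) n (M : manifold R n) (p : M) :
  set (chart R n M) := [set c | atlas c /\ dom c p].

Definition smooth_map (R : realType) m n (M : manifold R m) (N : manifold R n)
    (f : M -> N) : Prop :=
  continuous f /\
  forall c d, atlas c -> atlas d ->
    smooth_on (c @` (dom c `&` f @^-1` dom d)) (d \o f \o param c).

Section TangentSpace.
Context (R : realType) (n : nat) (M : manifold R n).

(* A tangent vector at p is given by its components in all the charts around
   p, related by the differentials of the changes of coordinates.  Components
   in the other charts are set to 0, so that equality of tangent vectors is
   equality of components. *)
Definition is_tangent (p : M) (v : chart R n M -> 'rV[R]_n) : Prop :=
  (forall c d, charts_at p c -> charts_at p d ->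
     v d = 'd (d \o param c) (c p) (v c)) /\
  (forall c, ~ charts_at p c -> v c = 0).

Definition tangent_pred (p : M) : {pred chart R n M -> 'rV[R]_n} :=
  fun v => `[< is_tangent p v >].

Record tangent (p : M) := Tangent {
  tcomp :> chart R n M -> 'rV[R]_n;
  tcompP : tcomp \in tangent_pred p }.

HB.instance Definition _ p := [isSub for @tcomp p].
HB.instance Definition _ p := [Choice of tangent p by <:].

Lemma tangent_submod_closed p : submod_closed (tangent_pred p).
Proof.
split.
  by apply/asboolP; split=> // c d _ _; rewrite linear0.
move=> a u v /asboolP[u1 u2] /asboolP[v1 v2]; apply/asboolP; split.
  move=> c d cp dp.
  rewrite -[(a *: u + v) c]/(a *: u c + v c) linearP.
  by rewrite [LHS]/(a *: u d + v d) (u1 c d)// (v1 c d).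
by move=> c cp; rewrite -[0](scaler0 _ a) -[RHS]addr0 -{1}(u2 c cp) -(v2 c cp).
Qed.

HB.instance Definition _ p :=
  GRing.isSubmodClosed.Build R (chart R n M -> 'rV[R]_n) (tangent_pred p)
    (tangent_submod_closed p).
HB.instance Definition _ p := [SubChoice_isSubLmodule of tangent p by <:].

Lemma tangent_eq p (u v : tangent p) : tcomp u =1 tcomp v -> u = v.
Proof. by move=> uv; apply/val_inj/funext. Qed.

End TangentSpace.

Section ChangeOfCharts.
Context (R : realType).

Lemma near_param n (M : topologicalType) (c : chart R n M) p (A : set M) :
  dom c p -> nbhs p A -> \forall y \near c p, A (param c y).
Proof.
by move=> cp pA; apply: (param_continuous cp); rewrite /= coordK.
Qed.

Lemma smooth_on_differentiable (V W : normedModType R) (U : set V)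
    (f : V -> W) x : smooth_on U f -> U x -> differentiable f x.
Proof. by move=> /(_ 1%N)[+ _]; exact. Qed.

Lemma near_diff_comp (U V W : normedModType R) (f : U -> V) (g : V -> W)
    (h : U -> W) x y v :
  y = f x -> differentiable f x -> differentiable g y -> differentiable h x ->
  (\near x, h x = g (f x)) -> 'd h x v = 'd g y ('d f x v).
Proof.
move=> -> df dg dh hgf.
have dgf : differentiable (g \o f) x by exact: differentiable_comp.
transitivity ('D_v (g \o f) x).
  rewrite -(deriveE v dh); exact: near_eq_derive.
by rewrite (deriveE v dgf) (diff_comp df dg).
Qed.

Lemma transition_differentiable n (M : manifold R n) (p : M)
    (c d : chart R n M) : charts_at p c -> charts_at p d ->
  differentiable (d \o param c) (c p).
Proof.
move=> [Mc cp] [Md dp].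
have [+ _] := (iffLR (atlas_maximal c) Mc) d Md.
by move=> /smooth_on_differentiable; apply; exists p.
Qed.

Lemma smooth_map_differentiable m n (M : manifold R m) (N : manifold R n)
    (f : M -> N) (p : M) (c : chart R m M) (d : chart R n N) :
  smooth_map f -> charts_at p c -> charts_at (f p) d ->
  differentiable (d \o f \o param c) (c p).
Proof.
move=> [_ fs] [Mc cp] [Nd dp].
by apply: smooth_on_differentiable (fs c d Mc Nd) _; exists p.
Qed.

Lemma smooth_map_changel m n (M : manifold R m) (N : manifold R n)
    (f : M -> N) (p : M) (c : chart R m M) (d e : chart R n N) v :
  smooth_map f -> charts_at p c -> charts_at (f p) d -> charts_at (f p) e ->
  'd (e \o f \o param c) (c p) v =
  'd (e \o param d) (d (f p)) ('d (d \o f \o param c) (c p) v).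
Proof.
move=> fs cp dp ep; apply: near_diff_comp.
- by rewrite /= coordK//; case: cp.
- exact: smooth_map_differentiable.
- exact: transition_differentiable.
- exact: smooth_map_differentiable.
have [Mc pc] := cp; have [Nd pd] := dp.
have : nbhs p (f @^-1` dom d).
  by apply: (fs.1 p); apply: open_nbhs_nbhs; split=> //; exact: dom_open.
by move=> /(near_param pc); apply: filterS => y fy /=; rewrite coordK.
Qed.

Lemma smooth_map_changer m n (M : manifold R m) (N : manifold R n)
    (f : M -> N) (p : M) (b c : chart R m M) (d : chart R n N) v :
  smooth_map f -> charts_at p b -> charts_at p c -> charts_at (f p) d ->
  'd (d \o f \o param b) (b p) v =
  'd (d \o f \o param c) (c p) ('d (c \o param b) (b p) v).
Proof.
move=> fs bp cp dp; apply: near_diff_comp.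
- by rewrite /= coordK//; case: bp.
- exact: transition_differentiable.
- exact: smooth_map_differentiable.
- exact: smooth_map_differentiable.
have [Mb pb] := bp; have [Mc pc] := cp.
have : nbhs p (dom c) by apply: open_nbhs_nbhs; split=> //; exact: dom_open.
by move=> /(near_param pb); apply: filterS => y fy /=; rewrite coordK.
Qed.

Lemma transition_comp n (M : manifold R n) (p : M) (b c d : chart R n M) v :
  charts_at p b -> charts_at p c -> charts_at p d ->
  'd (d \o param b) (b p) v =
  'd (d \o param c) (c p) ('d (c \o param b) (b p) v).
Proof.
move=> bp cp dp; apply: near_diff_comp.
- by rewrite /= coordK//; case: bp.
- exact: transition_differentiable.
- exact: transition_differentiable.
- exact: transition_differentiable.
have [Mb pb] := bp; have [Mc pc] := cp.
have : nbhs p (dom c) by apply: open_nbhs_nbhs; split=> //; exact: dom_open.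
by move=> /(near_param pb); apply: filterS => y fy /=; rewrite coordK.
Qed.

End ChangeOfCharts.

Section TangentMap.
Context (R : realType).

Definition chart_at n (M : manifold R n) (p : M) : chart R n M :=
  sval (cid2 (atlas_cover p)).

Lemma chart_atP n (M : manifold R n) (p : M) : charts_at p (chart_at p).
Proof. by rewrite /chart_at; case: cid2. Qed.

Section Def.
Context m n (M : manifold R m) (N : manifold R n) (f : M -> N)
  (fs : smooth_map f).

Definition tangent_map_comp (p : M) (v : tangent p) (d : chart R n N) :
    'rV[R]_n :=
  let c := chart_at p in
  if `[< charts_at (f p) d >] then 'd (d \o f \o param c) (c p) (v c) else 0.

Lemma tangent_map_subproof (p : M) (v : tangent p) :
  tangent_map_comp v \in tangent_pred (f p).
Proof.
apply/asboolP; split=> [c d cp dp|c cp]; rewrite /tangent_map_comp.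
  rewrite asboolT// asboolT//.
  by apply: smooth_map_changel => //; exact: chart_atP.
by rewrite asboolF.
Qed.

Definition tangent_map (p : M) (v : tangent p) : tangent (f p) :=
  Tangent (tangent_map_subproof v).

Lemma tangent_mapE (p : M) (v : tangent p) c d :
  charts_at p c -> charts_at (f p) d ->
  tangent_map v d = 'd (d \o f \o param c) (c p) (v c).
Proof.
move=> cp dp; rewrite /= /tangent_map_comp asboolT//.
have /asboolP[vE _] := tcompP v.
rewrite (vE (chart_at p) c)//; last exact: chart_atP.
by apply: smooth_map_changer => //; exact: chart_atP.
Qed.

End Def.

(* The coordinate vector d/dx^i of the chart c at p; 0 if p is not in the
   domain of c. *)
Definition coord_vector_comp n (M : manifold R n) (c : chart R n M) (p : M)
    (i : 'I_n) (d : chart R n M) : 'rV[R]_n :=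
  if `[< charts_at p c /\ charts_at p d >]
  then 'd (d \o param c) (c p) (delta_mx 0 i) else 0.

Lemma coord_vector_subproof n (M : manifold R n) (c : chart R n M) (p : M)
    (i : 'I_n) : coord_vector_comp c p i \in tangent_pred p.
Proof.
apply/asboolP; split=> [d e dp ep|d dp]; rewrite /coord_vector_comp; last first.
  by rewrite asboolF// => -[].
have [cp|cp] := pselect (charts_at p c).
  by rewrite asboolT// asboolT//; exact: transition_comp.
by rewrite asboolF ?asboolF ?linear0// => -[].
Qed.

Definition coord_vector n (M : manifold R n) (c : chart R n M) (p : M)
    (i : 'I_n) : tangent p :=
  Tangent (coord_vector_subproof c p i).

End TangentMap.

Section Tensors.
Context (R : realType).

(* g_ij as functions of the coordinates; they are used on [c @` dom c] only. *)
Definition tensor_comp n (M : manifold R n)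
    (g : forall p : M, tangent p -> tangent p -> R) (c : chart R n M)
    (i j : 'I_n) (y : 'rV[R]_n) : R :=
  g (param c y) (coord_vector c (param c y) i) (coord_vector c (param c y) j).

(* Smooth symmetric covariant 2-tensors, possibly degenerate. *)
Record sym2_tensor n (M : manifold R n) := Sym2Tensor {
  tensor_fun :> forall p : M, tangent p -> tangent p -> R;
  tensor_sym : forall p (v w : tangent p), tensor_fun v w = tensor_fun w v;
  tensor_linear : forall p (v : tangent p),
    linear (tensor_fun v : tangent p -> R^o);
  tensor_smooth : forall c, atlas c -> forall i j,
    smooth_on (c @` dom c) (tensor_comp tensor_fun c i j : _ -> R^o) }.

Definition nondegenerate_metric n (M : manifold R n) (g : sym2_tensor M) :
    Prop :=
  forall (p : M) (v : tangent p), (forall w, g p v w = 0) -> v = 0.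

Definition is_pullback m n (M : manifold R m) (N : manifold R n) (f : M -> N)
    (fs : smooth_map f) (h : sym2_tensor N) (g : sym2_tensor M) : Prop :=
  forall (p : M) (v w : tangent p),
    g p v w = h (f p) (tangent_map fs v) (tangent_map fs w).

(* (L_X g)_ij = X^k d_k g_ij + g_kj d_i X^k + g_ik d_j X^k in the chart c. *)
Definition lie_derivative_comp n (M : manifold R n)
    (X : forall p : M, tangent p) (g : sym2_tensor M) (c : chart R n M)
    (i j : 'I_n) (y : 'rV[R]_n) : R :=
  let D (k : 'I_n) (F : 'rV[R]_n -> R^o) := 'D_(delta_mx 0 k) F y in
  let X_ (k : 'I_n) (z : 'rV[R]_n) : R^o := X (param c z) c 0 k in
  let g_ (k l : 'I_n) := tensor_comp g c k l in
  \sum_(k < n) (X_ k y * D k (g_ i j) + g_ k j y * D i (X_ k)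
                + g_ i k y * D j (X_ k)).

Definition killing n (M : manifold R n) (X : forall p : M, tangent p)
    (g : sym2_tensor M) : Prop :=
  forall c, atlas c -> forall i j y, (c @` dom c) y ->
    lie_derivative_comp X g c i j y = 0.

End Tensors.

Section Bundles.
Context (R : realType) (n : nat).

(* Coordinates (x^a) on M and (x^a, t) on P in which the projection is
   (x, t) |-> x, the action of s is (x, t) |-> (x, s t), and P is the set
   t != 0. *)
Definition adapted (M : manifold R n) (P : manifold R (n + 1)) (proj : P -> M)
    (act : R -> P -> P) (c : chart R n M) (C : chart R (n + 1) P) : Prop :=
  [/\ dom C = proj @^-1` dom c,
      C @` dom C = [set y | (c @` dom c) (lsubmx y) /\ rsubmx y 0 0 != 0],
      forall p, dom C p -> lsubmx (C p) = c (proj p)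
    & forall s p, s != 0 -> dom C p ->
        C (act s p) = row_mx (c (proj p)) (s *: rsubmx (C p))].

(* Principal bundles over M for the multiplicative group of R.  Only the
   values of [act s] for s != 0 matter. *)
Record principal_bundle (M : manifold R n) := PrincipalBundle {
  total_space :> manifold R (n + 1);
  proj : total_space -> M;
  act : R -> total_space -> total_space;
  proj_smooth : smooth_map proj;
  act_smooth : forall s, s != 0 -> smooth_map (act s);
  act1 : forall p, act 1 p = p;
  actM : forall s t p, s != 0 -> t != 0 -> act (s * t) p = act s (act t p);
  proj_act : forall s p, s != 0 -> proj (act s p) = proj p;
  locally_trivial : forall x, exists c C,
    [/\ atlas c, dom c x, atlas C & adapted proj act c C] }.

Context (M : manifold R n) (P : principal_bundle M).

(* The fundamental vector field of the action is d/ds (e^s p) at s = 0, that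
   is d/ds (s p) at s = 1; in adapted coordinates it is t d/dt. *)
Definition euler_comp (p : P) (c : chart R (n + 1) P) : 'rV[R]_(n + 1) :=
  if `[< charts_at p c >] then derive1 (fun s : R => c (act s p)) 1 else 0.

Lemma near1_neq0 : \forall s \near (1 : R), s != 0.
Proof.
apply: (@cvgr_neq0 R R^o R (nbhs (1 : R)) _ id 1); first exact: cvg_id.
exact: oner_neq0.
Qed.

Lemma orbit_differentiable (p : P) (C : chart R (n + 1) P) (c : chart R n M) :
  dom C p -> adapted (@proj _ P) (@act _ P) c C ->
  differentiable (fun s : R => C (act s p)) (1 : R).
Proof.
move=> Cp [_ _ _ CE]; apply/derivable1_diffP.
set a := c (proj p); set b := rsubmx (C p).
apply: (@near_eq_derivable _ _ _ (fun s : R => row_mx a 0 + s *: row_mx 0 b)).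
  near=> s; rewrite CE//; last by near: s; exact: near1_neq0.
  by rewrite scale_row_mx scaler0 add_row_mx addr0 add0r.
by apply/derivable1_diffP; apply: differentiableD.
Unshelve. all: by end_near. Qed.

Lemma orbit_transition (p : P) (C d : chart R (n + 1) P) (c : chart R n M) :
  charts_at p C -> charts_at p d -> adapted (@proj _ P) (@act _ P) c C ->
  derive1 (fun s : R => d (act s p)) 1 =
  'd (d \o param C) (C p) (derive1 (fun s : R => C (act s p)) 1).
Proof.
move=> Cp dp aC; have [_ pC] := Cp; have dC := orbit_differentiable pC aC.
have CE : C p = C (act 1 p) by rewrite act1.
have dt := transition_differentiable Cp dp.
have E : \forall s \near (1 : R),
    d (param C (C (act s p))) = d (act s p).
  have [domC _ _ _] := aC; near=> s.
  rewrite coordK// domC /preimage /= proj_act; last first.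
    by near: s; exact: near1_neq0.
  by rewrite domC in pC.
have dd : differentiable (fun s : R => d (act s p)) (1 : R).
  apply/derivable1_diffP; apply: (near_eq_derivable E); apply/derivable1_diffP.
  apply: (differentiable_comp (f := fun s : R => C (act s p))
    (g := d \o param C)) => //.
  by rewrite -CE.
rewrite !derive1E !deriveE//.
apply: near_diff_comp => //.
by apply: filterS E => s /= ->.
Unshelve. all: by end_near. Qed.

Lemma euler_subproof (p : P) : euler_comp p \in tangent_pred p.
Proof.
apply/asboolP; split=> [d e dp ep|d dp]; rewrite /euler_comp; last first.
  by rewrite asboolF.
rewrite asboolT// asboolT//.
have [c [C [cM cx CP aC]]] := locally_trivial P (proj p).
have pC : charts_at p C by split=> //; case: aC => -> _ _ _.
rewrite (orbit_transition pC dp aC) (orbit_transition pC ep aC).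
exact: transition_comp.
Qed.

Definition euler (p : P) : tangent p := Tangent (euler_subproof p).

Definition vertical (p : P) (v : tangent p) : Prop :=
  tangent_map (@proj_smooth _ P) v = 0.

Definition carrollian (g : sym2_tensor P) : Prop :=
  forall (p : P) (v : tangent p), (forall w, g p v w = 0) <-> vertical v.

(* R^x is disconnected: [killing euler g] alone gives invariance under s > 0
   only. *)
Definition act_invariant (g : sym2_tensor P) : Prop :=
  forall s (s0 : s != 0), is_pullback (act_smooth P s0) g g.

Definition induced_metric (g : sym2_tensor P) (gM : sym2_tensor M) : Prop :=
  is_pullback (@proj_smooth _ P) gM g.

End Bundles.

(* Main.v *)
Require Import Defs.
From HB Require Import structures.
From mathcomp Require Import all_boot all_order all_algebra.
From mathcomp Require Import all_classical all_reals all_analysis.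

Set Implicit Arguments.
Unset Strict Implicit.
Unset Printing Implicit Defensive.

Import Order.TTheory GRing.Theory Num.Theory.
Import numFieldNormedType.Exports.

Local Open Scope classical_set_scope.
Local Open Scope ring_scope.

(** The metric g is invariant under the action, so it should only depend on the
    projections of its arguments to M.  Precisely, let v, v' be tangent at p and
    w, w' tangent at q, with the same projections to one point of M.  The fibres
    of the projection are the orbits ([fibre_orbit]), so q = s p; invariance
    replaces v, v' by their images under s, which have the same projections as
    w, w' and hence differ from them by vertical vectors.  These are in the
    kernel of g, so that g(v, v') = g(w, w') ([carrollian_lift]).

    The projection and its differential are surjective ([proj_surjective],
    [tangent_proj_surjective]).  Therefore g descends to a unique form on M:
    evaluate g on any lifts of the two tangent vectors ([descent]).  A vector u
    in the kernel of this form has lifts in the kernel of g; the latter are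
    vertical, so that u, being their projection, is 0
    ([induced_metric_nondegenerate]).

    Smoothness has to be checked in every chart d of M, while bundle coordinates
    exist only over some charts c.  Near a given point, the components of the
    descended form in d are the pullback, by the change of coordinates from d to
    c followed by the local section t = 1 of the bundle, of components of g; the
    partial derivatives of the change of coordinates enter as factors.  So
    smoothness follows from the stability of C^k functions under products
    ([Ck_mul]) and composition ([Ck_comp]); see [descent_smooth]. *)

(** * Functions of class C^k *)

Section Calculus.
Context (R : realType).
Implicit Types V W : normedModType R.

(** The derivative of f at x serves as the derivative of g: the little-o
    expansion of f at x only involves the germ of f. *)
Lemma near_eq_differentiable V W (f g : V -> W) x :
  (\near x, f x = g x) -> differentiable f x -> differentiable g x.
Proof.
move=> fg df; have fgx := nbhs_singleton fg.
have [dfc /eqaddoP fE] := (iffLR (diff_locallyP _ _) df).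
have gE : g \o shift x = cst (g x) + 'd f x +o_ 0 id.
  apply/eqaddoP => e e0; have := fE e e0.
  have fg0 : \forall h \near (0 : V), f (h + x) = g (h + x).
    by have := fg; rewrite (near_shift 0)/= subr0.
  by apply: filterS2 fg0 => h /= fgh; rewrite !fctE /= fgh fgx.
by apply/diff_locallyP; rewrite (diff_unique dfc gE).
Qed.

(** Being C^k is a local property.  The function f' may vary with the point x:
    this is what allows the expression of a tensor in a given chart to be
    computed with a different bundle chart around each point. *)
Lemma Ck_local V W k (U : set V) (f : V -> W) :
  (forall x, U x -> exists A f',
     [/\ open A, A x, forall y, A y -> f' y = f y & Ck k A f']) ->
  Ck k U f.
Proof.
elim: k f => [|k IH] f Uf /=.
  move=> x /Uf[A [f' [oA Ax ff' Cf']]].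
  have nA : nbhs x A by exact: open_nbhs_nbhs.
  rewrite -[{for x, continuous f}]/(f @ x --> f x) -(ff' x Ax).
  apply: cvg_trans (Cf' x Ax).
  by apply: near_eq_cvg; apply: filterS nA.
split=> [x /Uf[A [f' [oA Ax ff' [df' _]]]]|v].
  apply: near_eq_differentiable (df' x Ax).
  have nA : nbhs x A by exact: open_nbhs_nbhs.
  by apply: filterS nA.
apply: IH => x /Uf[A [f' [oA Ax ff' [_ Df']]]].
exists A, ('D_v f'); split=> [//|//|y Ay|]; last exact: Df'.
apply: near_eq_derive.
have nA : nbhs y A by exact: open_nbhs_nbhs.
by apply: filterS nA.
Qed.

Lemma Ck_ext V W k (U : set V) (f g : V -> W) : open U ->
  (forall x, U x -> f x = g x) -> Ck k U f -> Ck k U g.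
Proof. by move=> oU fg Cf; apply: Ck_local => x Ux; exists U, f. Qed.

Lemma CkW V W k (U : set V) (f : V -> W) : Ck k.+1 U f -> Ck k U f.
Proof.
elim: k f => [|k IH] f [df Df].
  by move=> x Ux; apply: differentiable_continuous; exact: df.
by split=> // v; apply: IH; exact: Df.
Qed.

Lemma Ck_cst V W k (U : set V) (a : W) : Ck k U (fun=> a).
Proof.
elim: k a => [|k IH] a /=; first by move=> x _; exact: cst_continuous.
split=> [x _|v]; first exact: differentiable_cst.
rewrite (_ : 'D_v _ = fun=> 0)//; apply/funext => x.
exact: derive_cst.
Qed.

Lemma Ck_add V W k (U : set V) (f g : V -> W) : open U ->
  Ck k U f -> Ck k U g -> Ck k U (fun x => f x + g x).
Proof.
move=> oU; elim: k f g => [|k IH] f g /=.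
  by move=> Cf Cg x Ux; apply: cvgD; [exact: Cf|exact: Cg].
move=> [df Df] [dg Dg]; split=> [x Ux|v].
  by apply: differentiableD; [exact: df|exact: dg].
apply: (Ck_ext (f := fun x => 'D_v f x + 'D_v g x)) => //; last exact: IH.
move=> x Ux; rewrite -deriveD//; apply: diff_derivable; [exact: df|exact: dg].
Qed.

Lemma Ck_sum V W k (U : set V) n (f : 'I_n -> V -> W) : open U ->
  (forall i, Ck k U (f i)) -> Ck k U (fun x => \sum_(i < n) f i x).
Proof.
move=> oU Cf.
elim: n f Cf => [|n IH] f Cf.
  apply: (Ck_ext (f := fun=> 0)) => //; last exact: Ck_cst.
  by move=> x _; rewrite big_ord0.
apply: (Ck_ext (f := fun x => f ord0 x + \sum_(i < n) f (lift ord0 i) x)) => //.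
  by move=> x _; rewrite big_ord_recl.
by apply: Ck_add => //; apply: IH => i; exact: Cf.
Qed.

Lemma Ck_mul V k (U : set V) (f g : V -> R^o) : open U ->
  Ck k U f -> Ck k U g -> Ck k U (fun x => f x * g x : R^o).
Proof.
move=> oU; elim: k f g => [|k IH] f g.
  by move=> Cf Cg x Ux; apply: cvgM; [exact: Cf|exact: Cg].
move=> Cf Cg; have [df Df] := Cf; have [dg Dg] := Cg; split=> [x Ux|v].
  by apply: differentiableM; [exact: df|exact: dg].
apply: (Ck_ext (f := fun x => f x * 'D_v g x + g x * 'D_v f x : R^o)) => //.
  move=> x Ux; rewrite -[LHS]/(f x *: 'D_v g x + g x *: 'D_v f x).
  by rewrite -deriveM//; apply: diff_derivable; [exact: df|exact: dg].
apply: Ck_add => //; apply: IH => //.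
- exact: CkW Cf.
- exact: Dg.
- exact: CkW Cg.
- exact: Df.
Qed.

(** Composition with a continuous linear map L commutes with directional
    derivatives, so the induction does not need the chain rule for C^k maps. *)
Lemma Ck_linear V W W' k (U : set V) (f : V -> W) (L : {linear W -> W'}) :
  continuous L -> open U -> Ck k U f -> Ck k U (L \o f).
Proof.
move=> cL oU; elim: k f => [|k IH] f /=.
  by move=> Cf x Ux; apply: continuous_comp (cL _); exact: Cf.
move=> [df Df]; split=> [x Ux|v].
  by apply: differentiable_comp; [exact: df|exact: linear_differentiable].
apply: (Ck_ext (f := L \o 'D_v f)) => //; last exact: IH.
move=> x Ux /=.
have dfx := df x Ux; have dL := linear_differentiable (f x) cL.
rewrite [RHS]deriveE; last exact: differentiable_comp.
by rewrite diff_comp//= diff_lin// deriveE.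
Qed.

Lemma Ck_coord V k (U : set V) n (f : V -> 'rV[R]_n) j : open U ->
  Ck k U f -> Ck k U (fun x => f x 0 j : R^o).
Proof.
have Llin : linear (fun v : 'rV[R]_n => v 0 j : R^o).
  by move=> a u v; rewrite !mxE.
pose Lm := GRing.isLinear.Build _ _ _ _ _ Llin.
pose L : {linear 'rV[R]_n -> R^o} := HB.pack (fun v : 'rV[R]_n => v 0 j : R^o) Lm.
by move=> oU; apply: (@Ck_linear _ _ _ _ _ _ L) => //; exact: coord_continuous.
Qed.

Lemma continuous_row_mx0 m n :
  continuous (fun v : 'rV[R]_m => row_mx v (0 : 'rV[R]_n)).
Proof.
move=> u A /nbhs_ballP[e /= e0 eA].
apply/nbhs_ballP; exists e => //= v [_ uv]; apply: eA.
split=> [|i j]; first by [].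
rewrite !mxE; case: (fintype.split j) => k; last exact: ballxx.
exact: uv.
Qed.

Lemma Ck_row_mx V k (U : set V) m n (f : V -> 'rV[R]_m) (a : 'rV[R]_n) :
  open U -> Ck k U f -> Ck k U (fun x => row_mx (f x) a).
Proof.
move=> oU Cf.
have Llin : linear (fun v : 'rV[R]_m => row_mx v (0 : 'rV[R]_n)).
  by move=> b u v; rewrite scale_row_mx add_row_mx scaler0 addr0.
pose Lm := GRing.isLinear.Build _ _ _ _ _ Llin.
pose L : {linear 'rV[R]_m -> 'rV[R]_(m + n)} :=
  HB.pack (fun v : 'rV[R]_m => row_mx v (0 : 'rV[R]_n)) Lm.
apply: (Ck_ext (f := fun x => L (f x) + row_mx 0 a)) => //.
  by move=> x _; rewrite add_row_mx addr0 add0r.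
apply: Ck_add => //; last exact: Ck_cst.
by apply: (@Ck_linear _ _ _ _ _ _ L) => //; exact: continuous_row_mx0.
Qed.

(** The derivative of g o f along v is a sum of products of components of the
    derivative of f, which is C^k when f is C^(k+1), and of partial derivatives
    of g composed with f, to which the induction hypothesis applies. *)
Lemma Ck_comp V k (U : set V) n (A : set 'rV[R]_n) (f : V -> 'rV[R]_n)
    (g : 'rV[R]_n -> R^o) :
  open U -> (forall x, U x -> A (f x)) -> Ck k U f -> Ck k A g ->
  Ck k U (g \o f).
Proof.
move=> oU UA; elim: k f UA g => [|k IH] f UA g.
  move=> Cf Cg x Ux; apply: continuous_comp; first exact: Cf.
  by apply: Cg; exact: UA.
move=> Cf [dg Dg]; have [df Df] := Cf; split=> [x Ux|v].
  by apply: differentiable_comp; [exact: df|exact/dg/UA].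
(* chain rule, expanded along the canonical basis *)
pose h x : R^o := \sum_(i < n) 'D_v f x 0 i * 'D_(delta_mx 0 i) g (f x).
apply: (Ck_ext (f := h)) => // [x Ux|].
  have dfx := df x Ux; have dgx := dg _ (UA x Ux).
  rewrite deriveE; last exact: differentiable_comp.
  rewrite diff_comp//= -(deriveE v dfx) [in RHS](row_sum_delta ('D_v f x)).
  rewrite linear_sum; apply: eq_bigr => i _.
  by rewrite [RHS]linearZ (deriveE _ dgx).
rewrite {}/h; apply: Ck_sum => // i; apply: Ck_mul => //.
  exact: (Ck_coord _ oU (Df v)).
exact: (IH f UA _ (CkW Cf) (Dg (delta_mx 0 i))).
Qed.

End Calculus.

(** * Components of tangent vectors and of tensors *)

Section TangentVectors.
Context (R : realType) (n : nat) (M : manifold R n).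
Implicit Types (p : M) (c d : chart R n M).

Lemma tcomp_change p (u : tangent p) c d : charts_at p c -> charts_at p d ->
  u d = 'd (d \o param c) (c p) (u c).
Proof. by have /asboolP[uE _] := tcompP u; exact: uE. Qed.

Lemma tcomp_out p (u : tangent p) c : ~ charts_at p c -> u c = 0.
Proof. by have /asboolP[_ uE] := tcompP u; exact: uE. Qed.

Lemma tangent_eq_chart p (u v : tangent p) c :
  charts_at p c -> u c = v c -> u = v.
Proof.
move=> cp uv; apply: tangent_eq => d.
have [dp|dp] := pselect (charts_at p d); last by rewrite !tcomp_out.
by rewrite !(tcomp_change _ cp dp) uv.
Qed.

Lemma tcomp_linear p a (u v : tangent p) c : (a *: u + v) c = a *: u c + v c.
Proof.
have /(congr1 (fun f => f c)) := linearP (val : tangent p -> _) a u v.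
by [].
Qed.

Lemma tcomp_comb p m (a : 'I_m -> R) (u : 'I_m -> tangent p) c :
  (\sum_(i < m) a i *: u i) c = \sum_(i < m) a i *: u i c.
Proof.
have E : val (\sum_(i < m) a i *: u i) = \sum_(i < m) a i *: val (u i).
  by rewrite linear_sum; apply: eq_bigr => i _; rewrite linearZ.
have := congr1 (fun f => f c) E; rewrite fct_sumE.
by move=> /= ->; apply: eq_bigr.
Qed.

Lemma coord_vector_self p c i :
  charts_at p c -> coord_vector c p i c = delta_mx 0 i.
Proof.
move=> cp; rewrite /= /coord_vector_comp asboolT//.
have dc := transition_differentiable cp cp.
rewrite -(deriveE _ dc) (near_eq_derive (g := id)) ?derive_id//.
have [_ pc] := cp.
have : nbhs (c p) (c @` dom c).
  by apply: open_nbhs_nbhs; split; [exact: cod_open|exists p].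
by apply: filterS => _ [q cq <-] /=; rewrite coordK.
Qed.

Lemma tangent_with p c (w : 'rV[R]_n) :
  charts_at p c -> exists u : tangent p, u c = w.
Proof.
move=> cp; exists (\sum_(i < n) w 0 i *: coord_vector c p i).
rewrite tcomp_comb [RHS]row_sum_delta; apply: eq_bigr => i _.
by rewrite coord_vector_self.
Qed.

Lemma tangent_decomp p c (u : tangent p) : charts_at p c ->
  u = \sum_(i < n) u c 0 i *: coord_vector c p i.
Proof.
move=> cp; apply: (tangent_eq_chart cp).
rewrite tcomp_comb [LHS]row_sum_delta; apply: eq_bigr => i _.
by rewrite coord_vector_self.
Qed.

Lemma tensor_combr (g : sym2_tensor M) p (u : tangent p) m (a : 'I_m -> R)
    (v : 'I_m -> tangent p) :
  g p u (\sum_(i < m) a i *: v i) = \sum_(i < m) a i * g p u (v i).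
Proof.
pose Lm := GRing.isLinear.Build _ _ _ _ _ (tensor_linear g u).
pose L : {linear tangent p -> R^o} := HB.pack (g p u : tangent p -> R^o) Lm.
rewrite -[LHS]/(L _) linear_sum; apply: eq_bigr => i _.
by rewrite linearZ.
Qed.

Lemma tensor_combl (g : sym2_tensor M) p (u : tangent p) m (a : 'I_m -> R)
    (v : 'I_m -> tangent p) :
  g p (\sum_(i < m) a i *: v i) u = \sum_(i < m) a i * g p (v i) u.
Proof.
by rewrite tensor_sym tensor_combr; apply: eq_bigr => i _; rewrite tensor_sym.
Qed.

Lemma tensorBr (g : sym2_tensor M) p (u v w : tangent p) :
  g p u (v - w) = g p u v - g p u w.
Proof.
pose Lm := GRing.isLinear.Build _ _ _ _ _ (tensor_linear g u).
pose L : {linear tangent p -> R^o} := HB.pack (g p u : tangent p -> R^o) Lm.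
by rewrite -[LHS]/(L _) linearB.
Qed.

(** The base point has the form [param c y] because [tensor_comp] evaluates the
    tensor there; this avoids transporting u and v along [coordK]. *)
Lemma tensor_chartE (g : sym2_tensor M) c y (u v : tangent (param c y)) :
  atlas c -> (c @` dom c) y ->
  g _ u v = \sum_(i < n) \sum_(j < n)
    u c 0 i * (v c 0 j * tensor_comp g c i j y).
Proof.
move=> Mc [q cq qy].
have cp : charts_at (param c y) c by split=> //; rewrite -qy coordK.
rewrite {1}(tangent_decomp u cp) {1}(tangent_decomp v cp) tensor_combl.
apply: eq_bigr => i _; rewrite tensor_combr big_distrr.
by apply: eq_bigr.
Qed.

End TangentVectors.

Section TangentMaps.
Context (R : realType) (m n : nat) (M : manifold R m) (N : manifold R n)
  (f : M -> N) (fs : smooth_map f).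

Lemma tangent_map_linear p : linear (@tangent_map _ _ _ _ _ _ fs p).
Proof.
move=> a u v; apply: (tangent_eq_chart (chart_atP (f p))).
have cp := chart_atP p; have dp := chart_atP (f p).
by rewrite tcomp_linear !(tangent_mapE fs _ cp dp) tcomp_linear linearP.
Qed.

Lemma tangent_mapB p (u v : tangent p) :
  tangent_map fs (u - v) = tangent_map fs u - tangent_map fs v.
Proof.
pose Lm := GRing.isLinear.Build _ _ _ _ _ (@tangent_map_linear p).
pose L : {linear tangent p -> tangent (f p)} :=
  HB.pack (@tangent_map _ _ _ _ _ _ fs p) Lm.
by rewrite -[LHS]/(L _) linearB.
Qed.

End TangentMaps.

(** * Projection of a principal bundle *)

Section Bundle.
Context (R : realType) (n : nat) (M : manifold R n) (P : principal_bundle M).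
Let pi : P -> M := @Defs.proj _ _ _ P.
Let pi_smooth : smooth_map pi := @Defs.proj_smooth _ _ _ P.

Lemma adapted_point (p : P) : exists c C,
  [/\ charts_at (pi p) c, charts_at p C & adapted pi (@act _ _ _ P) c C].
Proof.
have [c [C [Mc cp PC aC]]] := locally_trivial P (pi p).
by exists c, C; split=> //; split=> //; have [-> _ _ _] := aC.
Qed.

(** The point with bundle coordinates (x, 1) lies over x. *)
Lemma proj_surjective (x : M) : exists p : P, pi p = x.
Proof.
have [c [C [Mc cx PC [dC CC lC _]]]] := locally_trivial P x.
have : (C @` dom C) (row_mx (c x) 1%:M).
  by rewrite CC /= row_mxKl row_mxKr mxE oner_neq0; split=> //; exists x.
move=> [p Cp pE]; exists p.
have := lC p Cp; rewrite pE row_mxKl => cE.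
by rewrite -(coordK cx) cE coordK//; move: Cp; rewrite dC.
Qed.

(** In bundle coordinates p = (x, t) and q = (x, t') with t, t' nonzero, so that
    s = t' / t works. *)
Lemma fibre_orbit (p q : P) : pi p = pi q -> exists2 s, s != 0 & q = act s p.
Proof.
move=> pq; have [c [C [[Mc cp] [PC Cp] [dC CC lC aC]]]] := adapted_point p.
have Cq : dom C q by rewrite dC /preimage/mkset -pq.
have t_neq0 r : dom C r -> rsubmx (C r) 0 0 != 0.
  move=> Cr; have : (C @` dom C) (C r) by exists r.
  by rewrite CC => -[].
exists (rsubmx (C q) 0 0 / rsubmx (C p) 0 0).
  by rewrite mulf_neq0 ?invr_neq0 ?t_neq0.
set s := _ / _.
have s0 : s != 0 by rewrite mulf_neq0 ?invr_neq0 ?t_neq0.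
have Csp : dom C (act s p) by rewrite dC /preimage/mkset /pi proj_act.
rewrite -(coordK Cq) -[RHS](coordK Csp) (aC s p s0 Cp); congr (param C _).
rewrite -[LHS]hsubmxK; congr row_mx; first by rewrite lC// -pq.
by apply/rowP => i; rewrite ord1 [RHS]mxE /s divfK// t_neq0.
Qed.

(** In bundle coordinates the projection is (x, t) |-> x, which is linear and
    thus its own differential. *)
Lemma tangent_proj_adapted (p : P) (v : tangent p) c C :
  charts_at (pi p) c -> charts_at p C -> adapted pi (@act _ _ _ P) c C ->
  tangent_map pi_smooth v c = lsubmx (v C).
Proof.
move=> cp Cp [dC CC lC aC]; rewrite (tangent_mapE pi_smooth _ Cp cp).
have ds := smooth_map_differentiable pi_smooth Cp cp.
have dl := @differentiable_lsubmx R 1 n 1 (C p).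
transitivity ('D_(v C) (lsubmx : 'rV[R]_(n + 1) -> 'rV[R]_n) (C p)).
  rewrite -(deriveE _ ds); apply: near_eq_derive.
  have : nbhs (C p) (C @` dom C).
    by apply: open_nbhs_nbhs; split; [exact: cod_open|exists p => //; case: Cp].
  by apply: filterS => _ [q Cq <-] /=; rewrite coordK// lC.
rewrite deriveE// (diff_lin (f := lsubmx)) //; exact: continuous_lsubmx.
Qed.

Lemma tangent_proj_surjective (p : P) (u : tangent (pi p)) :
  exists v : tangent p, tangent_map pi_smooth v = u.
Proof.
have [c [C [cp Cp aC]]] := adapted_point p.
have [v vE] := tangent_with (row_mx (u c) 0) Cp.
exists v; apply: (tangent_eq_chart cp).
by rewrite (tangent_proj_adapted v cp Cp aC) vE row_mxKl.
Qed.

(** The chain rule for pi o s = pi.  The two sides are tangent at [pi (act s p)]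
    and at [pi p], which are equal but not convertible; comparing the families
    of components avoids a transport. *)
Lemma tangent_proj_act s (s0 : s != 0) (p : P) (u : tangent p) :
  tcomp (tangent_map pi_smooth (tangent_map (act_smooth P s0) u)) =
  tcomp (tangent_map pi_smooth u).
Proof.
apply/funext => d.
have piE : pi (act s p) = pi p by exact: proj_act.
have [dp|dp] := pselect (charts_at (pi p) d); last first.
  by rewrite !tcomp_out// piE.
have Cp := chart_atP p; have Dp := chart_atP (act s p).
set C := chart_at p in Cp *; set D := chart_at (act s p) in Dp *.
have dsp : charts_at (pi (act s p)) d by rewrite piE.
rewrite (tangent_mapE pi_smooth _ Dp dsp).
rewrite (tangent_mapE (act_smooth P s0) _ Cp Dp) (tangent_mapE pi_smooth _ Cp dp).
apply/esym; apply: near_diff_comp.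
- by rewrite /= coordK//; case: Cp.
- exact: (smooth_map_differentiable (act_smooth P s0)).
- exact: (smooth_map_differentiable pi_smooth).
- exact: (smooth_map_differentiable pi_smooth).
have [_ pC] := Cp; have [_ pD] := Dp.
have : nbhs p (act s @^-1` dom D).
  by apply: ((act_smooth P s0).1 p); apply: open_nbhs_nbhs; split=> //;
    exact: dom_open.
move=> /(near_param pC); apply: filterS => y Dy /=.
by rewrite coordK// /pi proj_act.
Qed.

(** Move p to q by the action, under which g is invariant, and then modify each
    argument by a vertical vector, which is in the kernel of g. *)
Lemma carrollian_lift (g : sym2_tensor P) (p q : P) (v v' : tangent p)
    (w w' : tangent q) : carrollian g -> act_invariant g ->
  pi p = pi q ->
  tcomp (tangent_map pi_smooth v) = tcomp (tangent_map pi_smooth w) ->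
  tcomp (tangent_map pi_smooth v') = tcomp (tangent_map pi_smooth w') ->
  g p v v' = g q w w'.
Proof.
move=> cg ig pq.
have [s s0 qE] := fibre_orbit pq; subst q => vw vw'.
(* vertical perturbations of the first argument do not change g *)
have gB (u u' u'' : tangent (act s p)) :
    tcomp (tangent_map pi_smooth u) = tcomp (tangent_map pi_smooth u') ->
    g _ u u'' = g _ u' u''.
  move=> uu'.
  have /cg : vertical (u - u').
    rewrite /vertical tangent_mapB; apply/eqP; rewrite subr_eq0; apply/eqP.
    by apply: tangent_eq => d; rewrite uu'.
  move=> /(_ u''); rewrite tensor_sym tensorBr => /eqP; rewrite subr_eq0 => /eqP.
  by rewrite ![g _ u'' _]tensor_sym.
rewrite (ig s s0); set a := tangent_map _ v; set a' := tangent_map _ v'.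
rewrite (gB a w) ?tangent_proj_act// tensor_sym (gB a' w') ?tangent_proj_act//.
exact: tensor_sym.
Qed.

End Bundle.

(** The chart is a homeomorphism onto an open set, although its inverse [param]
    is only controlled on the image of the domain. *)
Lemma chart_image_open (R : realType) n (M : topologicalType)
    (c : chart R n M) (A : set M) : open A -> open (c @` (dom c `&` A)).
Proof.
move=> oA; rewrite openE => y [p [cp Ap] <-].
have nc : nbhs (c p) (c @` dom c).
  by apply: open_nbhs_nbhs; split; [exact: cod_open|exists p].
have nA : nbhs p A by exact: open_nbhs_nbhs.
have := near_param cp nA; rewrite /interior/=; apply: filterS2 nc.
by move=> _ [q cq <-]; rewrite coordK// => Aq; exists q.
Qed.

(** A form of [tangent_eq_chart] for tangent vectors whose base points are only
    propositionally equal. *)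
Lemma tcomp_eq_chart (R : realType) n (M : manifold R n) (p q : M)
    (u : tangent p) (v : tangent q) c :
  p = q -> charts_at p c -> u c = v c -> tcomp u = tcomp v.
Proof. by move=> pq; subst q => cp uv; rewrite (tangent_eq_chart cp uv). Qed.

Lemma sym2_tensor_eq (R : realType) n (M : manifold R n) (g h : sym2_tensor M) :
  (forall p (u v : tangent p), g p u v = h p u v) -> g = h.
Proof.
case: g h => [g gs gl gC] [h hs hl hC] /= gh.
have E : g = h by apply/functional_extensionality_dep => p; apply/funext => u;
  apply/funext => v; exact: gh.
by subst h; congr Sym2Tensor; exact: Prop_irrelevance.
Qed.

(** * The descended metric *)

Section Descent.
Context (R : realType) (n : nat) (M : manifold R n) (P : principal_bundle M).
Context (g : sym2_tensor P) (cg : carrollian g) (ig : act_invariant g).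
Let pi : P -> M := @Defs.proj _ _ _ P.
Let pi_smooth : smooth_map pi := @Defs.proj_smooth _ _ _ P.

(** The common value of g on all pairs of lifts of u and v; it is chosen among
    the values on pairs of lifts at arbitrary points p of the fibre, so that it
    needs no section of the bundle.  Projections are compared by components
    because they are tangent at [pi p] rather than at x. *)
Definition descent (x : M) (u v : tangent x) : R :=
  xget 0 [set r | exists (p : P) (u' v' : tangent p),
    [/\ pi p = x, tcomp (tangent_map pi_smooth u') = tcomp u,
        tcomp (tangent_map pi_smooth v') = tcomp v & r = g p u' v']].

Lemma descentE (p : P) (u' v' : tangent p) (x : M) (u v : tangent x) :
  pi p = x -> tcomp (tangent_map pi_smooth u') = tcomp u ->
  tcomp (tangent_map pi_smooth v') = tcomp v ->
  descent u v = g p u' v'.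
Proof.
move=> px uE vE; rewrite /descent.
set S := (X in xget _ X).
have : S (xget 0 S) by apply: (xgetPex 0); exists (g p u' v'), p, u', v'.
move=> [q [u'' [v'' [qx u''E v''E ->]]]].
by apply: (carrollian_lift cg ig); rewrite -/pi ?px// ?u''E ?v''E.
Qed.

Lemma descent_proj (p : P) (u' v' : tangent p) :
  descent (tangent_map pi_smooth u') (tangent_map pi_smooth v') = g p u' v'.
Proof. exact: descentE. Qed.

Lemma descent_sym (x : M) (u v : tangent x) : descent u v = descent v u.
Proof.
have [p px] := proj_surjective P x; subst x.
have [u' <-] := tangent_proj_surjective u.
have [v' <-] := tangent_proj_surjective v.
by rewrite !descent_proj tensor_sym.
Qed.

Lemma descent_linear (x : M) (u : tangent x) :
  linear (descent u : tangent x -> R^o).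
Proof.
have [p px] := proj_surjective P x; subst x => a v w.
have [u' <-] := tangent_proj_surjective u.
have [v' <-] := tangent_proj_surjective v.
have [w' <-] := tangent_proj_surjective w.
by rewrite -tangent_map_linear !descent_proj tensor_linear.
Qed.

(** On the overlap of d with a chart c that has a bundle chart C over it, lift
    the coordinate vectors of d along the section t = 1 of C.  The lifts have as
    coordinates the partial derivatives of the change of coordinates phi,
    completed by 0 in the fibre direction, so the component of the descended
    metric is the bilinear expression h in smooth functions. *)
Lemma descent_smooth (d : chart R n M) : atlas d -> forall i j,
  smooth_on (d @` dom d) (tensor_comp descent d i j : _ -> R^o).
Proof.
move=> Md i j k; apply: Ck_local => _ [x0 dx0 <-].
have [c [C [Mc cx0 PC aC]]] := locally_trivial P x0.
have [dC CC lC _] := aC.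
pose W := d @` (dom d `&` dom c); pose phi := c \o param d.
have oW : open W by apply: chart_image_open; exact: dom_open.
have phis : smooth_on W phi by have [] := (iffLR (atlas_maximal d) Md) c Mc.
pose s y : 'rV[R]_(n + 1) := row_mx (phi y) 1%:M.
pose D l y : 'rV[R]_(n + 1) := row_mx ('D_(delta_mx 0 l) phi y) 0.
have sW y : W y -> (C @` dom C) (s y).
  move=> [x [dx cx] <-]; rewrite CC /= row_mxKl row_mxKr mxE oner_neq0.
  by split=> //; exists x => //; rewrite /phi/= coordK.
pose h y : R^o := \sum_(a < n + 1) \sum_(b < n + 1)
  D i y 0 a * (D j y 0 b * tensor_comp g C a b (s y)).
exists W, h; split; [exact: oW|by exists x0|move=> y Wy|].
  have [x [dx cx] yE] := Wy; subst y.
  have [q Cq qE] := sW _ Wy.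
  set y := d x in Wy qE *.
  have xy : param d y = x by rewrite /y coordK.
  have Cp : charts_at (param C (s y)) C by rewrite -qE coordK.
  have pix : pi (param C (s y)) = param d y.
    rewrite -qE coordK// xy.
    have cq : dom c (pi q) by move: Cq; rewrite dC.
    have := lC q Cq; rewrite qE row_mxKl /phi/= xy => cE.
    by rewrite -(coordK cx) cE coordK.
  have cp : charts_at (pi (param C (s y))) c by rewrite pix xy.
  (* the lift of the l-th coordinate vector of d to the section *)
  have lift l : exists2 u : tangent (param C (s y)), u C = D l y &
      tcomp (tangent_map pi_smooth u) = tcomp (coord_vector d (param d y) l).
    have [u uC] := tangent_with (D l y) Cp; exists u => //.
    apply: (tcomp_eq_chart pix cp).
    rewrite (tangent_proj_adapted u cp Cp aC) uC row_mxKl /=.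
    rewrite /coord_vector_comp xy asboolT// deriveE//.
    by apply: smooth_on_differentiable phis _.
  have [u uC uE] := lift i; have [v vC vE] := lift j.
  rewrite /tensor_comp (descentE pix uE vE) (tensor_chartE g u v PC (sW y Wy)).
  by rewrite uC vC.
have Ds l a : Ck k W (fun y => D l y 0 a : R^o).
  apply: Ck_coord => //; apply: Ck_row_mx => //.
  by have [_ /(_ (delta_mx 0 l))] := phis k.+1.
apply: Ck_sum => // a; apply: Ck_sum => // b.
apply: Ck_mul => //; apply: Ck_mul => //.
apply: (Ck_comp oW sW); last exact: tensor_smooth.
by apply: Ck_row_mx.
Qed.

Definition descended_metric : sym2_tensor M :=
  Sym2Tensor descent_sym descent_linear descent_smooth.

Lemma descended_metric_induced : induced_metric g descended_metric.
Proof. by move=> p u v; rewrite /= descent_proj. Qed.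

End Descent.

Section Induced.
Context (R : realType) (n : nat) (M : manifold R n) (P : principal_bundle M).
Context (g : sym2_tensor P).

(** Every pair of tangent vectors of M is the projection of a pair of tangent
    vectors of P, where the pullback condition prescribes the value. *)
Lemma induced_metric_unique (h h' : sym2_tensor M) :
  induced_metric g h -> induced_metric g h' -> h = h'.
Proof.
move=> gh gh'; apply: sym2_tensor_eq => x u v.
have [p px] := proj_surjective P x; subst x.
have [u' <-] := tangent_proj_surjective u.
have [v' <-] := tangent_proj_surjective v.
by rewrite -gh -gh'.
Qed.

Lemma induced_metric_nondegenerate (h : sym2_tensor M) :
  carrollian g -> induced_metric g h -> nondegenerate_metric h.
Proof.
move=> cg gh x u u0; have [p px] := proj_surjective P x; subst x.
have [u' u'E] := tangent_proj_surjective u.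
rewrite -u'E in u0 *.
by apply/cg => w; rewrite gh; exact: u0.
Qed.

End Induced.

Theorem proposition3p3 (R : realType) (n : nat) (M : manifold R n)
  (P : principal_bundle M) (g : sym2_tensor P)
  (g_carrollian : carrollian g)
  (euler_killing : killing (@euler R n M P) g)
  (g_invariant : act_invariant g) :
  exists gM : sym2_tensor M,
    unique (induced_metric g) gM /\ nondegenerate_metric gM.
Proof.
exists (descended_metric g_carrollian g_invariant).
have gM := descended_metric_induced g_carrollian g_invariant.
split; last exact: induced_metric_nondegenerate gM.
by split=> // h; exact: induced_metric_unique.
Qed.
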